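(* Every net $(P_\alpha)$ of probability measures on $(\mathcal{F},\mathcal{B}_F)$ is weakly convergent on $(\mathcal{F}, \tau_{uF})$ with limit $\delta_E$, the Dirac measure at the point $E\in\mathcal{F}$. Moreover, if $P_\alpha \rightarrow_w P$ on $(\mathcal{F}, \tau_{uF})$ for a probability measure $P$ on $(\mathcal{F},\mathcal{B}_F)$, then $P_\alpha \rightarrow_w Q$ on $(\mathcal{F}, \tau_{uF})$ for each probability measure $Q$ on $(\mathcal{F},\mathcal{B}_F)$ that dominates $P$.
   Context: $(E,\mathcal{G})$ is a non-empty locally compact, second-countable Hausdorff space; $\mathcal{G}$ is the family of its open sets, and $\mathcal{F}$ and $\mathcal{K}$ are the families of all closed and all compact subsets of $E$. For $A\subseteq E$ put $\mathcal{M}(A)=\{F\in\mathcal{F}: F\cap A=\emptyset\}$ and $\mathcal{H}(A)=\{F\in\mathcal{F}: F\cap A\neq\emptyset\}$. The Fell topology $\tau_F$ on $\mathcal{F}$ is generated by $\{\mathcal{M}(K):K\in\mathcal{K}\}\cup\{\mathcal{H}(G):G\in\mathcal{G}\}$; the upper Fell topology $\tau_{uF}$ on $\mathcal{F}$ is generated by $\{\mathcal{M}(K):K\in\mathcal{K}\}$. Their Borel $\sigma$-algebras coincide: $\mathcal{B}_F:=\sigma(\tau_F)=\sigma(\tau_{uF})$. $Q$ dominates $P$ if $P(\bigcap_{i=1}^m \mathcal{H}(K_i))\le Q(\bigcap_{i=1}^m \mathcal{H}(K_i))$ for every $m\in\mathbb{N}$ and every collection $K_1,\ldots,K_m$ of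 non-empty compact sets in $E$. Weak convergence: for a topological space $(X,\mathcal{O})$ and a net $(P_\alpha)_{\alpha\in A}$ ($A$ a directed set) of probability measures and a probability measure $P$ on $(X,\sigma(\mathcal{O}))$, $P_\alpha\rightarrow_w P$ on $(X,\mathcal{O})$ means convergence in the weak topology, i.e. the initial topology on the set of probability measures with respect to the maps $P\mapsto P(O)$, $O\in\mathcal{O}$, into $\mathbb{R}$ with the topology $\{(a,\infty):a\in\mathbb{R}\}\cup\{\emptyset,\mathbb{R}\}$. Equivalently: $\liminf_\alpha P_\alpha(O)\ge P(O)$ for all $O\in\mathcal{O}$; equivalently: $\limsup_\alpha P_\alpha(F)\le P(F)$ for all closed sets $F$ of $(X,\mathcal{O})$. *)

(* Defs.v *)
From HB Require Import structures.
From mathcomp Require Import all_boot all_order all_algebra finmap.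
From mathcomp Require Import all_classical all_reals all_analysis.

Set Implicit Arguments.
Unset Strict Implicit.
Unset Printing Implicit Defensive.
Import Order.TTheory GRing.Theory Num.Theory.

Local Open Scope classical_set_scope.
Local Open Scope ring_scope.

Record closed_set (E : topologicalType) := ClosedSet {
  closed_set_val :> set E;
  closed_setP : closed closed_set_val }.

Definition closed_setT (E : topologicalType) : closed_set E := ClosedSet closedT.

HB.instance Definition _ (E : topologicalType) :=
  gen_eqMixin (closed_set E).
HB.instance Definition _ (E : topologicalType) :=
  gen_choiceMixin (closed_set E).
HB.instance Definition _ (E : topologicalType) :=
  isPointed.Build (closed_set E) (closed_setT E).

Definition miss (E : topologicalType) (A : set E) : set (closed_set E) :=
  [set F | F `&` A = set0].

Definition hit (E : topologicalType) (A : set E) : set (closed_set E) :=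
  [set F | F `&` A !=set0].

(* [fell E] and [upper_fell E] are aliases of [closed_set E], carrying two
   different topologies. *)
Definition fell (E : topologicalType) : Type := closed_set E.

HB.instance Definition _ (E : topologicalType) := Pointed.on (fell E).
HB.instance Definition _ (E : topologicalType) :=
  isSubBaseTopological.Build (fell E)
    ([set miss K | K in @compact E] `|` [set hit G | G in @open E]) id.

Definition upper_fell (E : topologicalType) : Type := closed_set E.

HB.instance Definition _ (E : topologicalType) := Pointed.on (upper_fell E).
HB.instance Definition _ (E : topologicalType) :=
  isSubBaseTopological.Build (upper_fell E) [set miss K | K in @compact E] id.

Notation borel X := (g_sigma_algebraType (@open X)).

Section fell_borel.
Context (E : topologicalType) (E0 : [set: E] !=set0)
  (lcE : locally_compact [set: E]) (scE : @second_countable E)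
  (hE : hausdorff_space E).

Lemma miss_measurable (K : set E) :
  compact K -> <<s @open (upper_fell E) >> (miss K).
Proof.
move=> cK; apply: sub_sigma_algebra; exists [set miss K]; last by rewrite bigcup_set1.
by move=> _ ->; apply: (@finI_from1 _ _ _ id); exists K.
Qed.

Lemma basis_nbhs (B : set (set E)) (x : E) (N : set E) : basis B -> nbhs x N ->
  exists U, [/\ B U, U x, compact (closure U) & closure U `<=` N].
Proof.
move=> [_ Bb] xN; have [V xV [cV _]] := lcE (I : setT x).
rewrite withinET in xV.
have [W xW WN] := compact_regular hE cV xV (filterI xN xV).
have [U [BU Ux] UW] := Bb _ _ xW; exists U; split => //.
  apply: (subclosed_compact _ cV); first exact: closed_closure.
  by move=> y /(closureS UW)/WN[].
by move=> y /(closureS UW)/WN[].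
Qed.

Lemma hitE (A : set E) : hit A = ~` miss A.
Proof.
apply/seteqP; split=> F /=; first by move=> /set0P/eqP.
by move=> /eqP/set0P.
Qed.

Lemma bigcup_sigma (D : set (set (closed_set E))) : countable D ->
  (forall C, D C -> <<s @open (upper_fell E) >> C) ->
  <<s @open (upper_fell E) >> (\bigcup_(C in D) C).
Proof.
move=> cD mD; rewrite bigcup_set_type.
apply: (@countable_bigcupT_measurable _ (borel (upper_fell E))).
  by rewrite (eq_countable (card_setT _)).
by move=> C; apply: mD; exact: set_valP.
Qed.

Lemma hit_measurable (G : set E) :
  open G -> <<s @open (upper_fell E) >> (hit G).
Proof.
move=> oG; have [B cB bB] := scE.
pose D := [set U | [/\ B U, compact (closure U) & closure U `<=` G]].
have -> : hit G = \bigcup_(C in [set hit (closure U) | U in D]) C.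
  rewrite bigcup_image; apply/seteqP; split=> F /=.
    move=> [x [Fx Gx]].
    have [U [BU Ux cU UG]] := basis_nbhs bB (open_nbhs_nbhs (conj oG Gx)).
    by exists U => //; exists x; split => //; exact: subset_closure.
  by move=> [U [_ _ UG] [x [Fx Ux]]]; exists x; split => //; exact: UG.
apply: bigcup_sigma.
  apply: (card_le_trans (card_image_le _ _)).
  by apply: sub_countable cB; apply: subset_card_le => U [].
move=> _ [U [_ cU _] <-]; rewrite hitE.
exact: (@measurableC _ (borel (upper_fell E)) _ (miss_measurable cU)).
Qed.

(* Hence [borel (upper_fell E)] is also the Borel sigma-algebra of [fell E]. *)
Lemma sigma_fellE :
  <<s @open (fell E) >> = <<s @open (upper_fell E) >> :> set (set (closed_set E)).
Proof.
apply/seteqP; split; last first.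
  apply: sub_sigma_algebra2 => _ [D fD <-]; exists D => // C /fD[D' sD' <-].
  by exists D' => // K /sD'; rewrite !inE; left.
apply: smallest_sub; first exact: smallest_sigma_algebra.
move=> A oA; have [B cB bB] := scE; have [e _] := E0.
pose W : set (set (closed_set E)) :=
  [set miss (closure U) | U in [set U | B U /\ compact (closure U)]]
  `|` [set hit U | U in B].
have cW : countable W.
  rewrite /W -bigcup2E; apply: bigcup_countable => // -[|[|i]] _ //=;
    apply: (card_le_trans (card_image_le _ _)) => //.
  by apply: sub_countable cB; apply: subset_card_le => U [].
have mW C : W C -> <<s @open (upper_fell E) >> C.
  move=> [[U [_ cU] <-]|[U BU <-]]; first exact: miss_measurable.
  by apply: hit_measurable; exact: bB.1.
pose D := [set C | finI_from W id C /\ C `<=` A].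
suff -> : A = \bigcup_(C in D) C.
  apply: bigcup_sigma.
    apply: sub_countable (finI_from_countable id cW).
    by apply: subset_card_le => C [].
  move=> _ [[D' sD' <-] _].
  rewrite bigcap_fset big_seq.
  apply: (@bigsetI_measurable _ (borel (upper_fell E))) => C /sD'.
  by rewrite inE; exact: mW.
apply/seteqP; split => [F AF|F [C [_ CA] /CA//]].
pose N := filter_from [set C | finI_from W id C /\ C F] id.
have FN : Filter N.
  apply: filter_from_filter.
    exists setT; split => //; exists fset0%fset => //.
    by rewrite set_fset0 bigcap_set0.
  move=> C C' [WC CF] [WC' C'F]; exists (C `&` C') => //.
  by split => //; exact: finI_fromI.
have NW C : W C -> C F -> N C.
  by move=> WC CF; exists C => //; split => //; exact: (finI_from1 id WC).
suff [C [WC CF] CA] : N A by exists C.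
have [S sS SA] := oA.
move: AF; rewrite -SA => -[C SC CF].
apply: (@filterS _ _ _ C); first by move=> x Cx; exists C.
have [D' sD' D'C] := sS _ SC; rewrite -D'C; apply: filter_bigI => /= C' D'C'.
have C'F : C' F by move: CF; rewrite -D'C => /(_ _ D'C').
have := sD' _ D'C'; rewrite inE => -[[K cK KC']|[G oG GC']]; last first.
  move: C'F; rewrite -GC' => -[x [Fx Gx]].
  have [U [BU Ux _ UG]] := basis_nbhs bB (open_nbhs_nbhs (conj oG Gx)).
  apply: (@filterS _ _ _ (hit U)).
    move=> F' [y [F'y Uy]]; exists y; split => //.
    exact/UG/subset_closure.
  by apply: NW; [right; exists U|exists x].
move: C'F; rewrite -KC' => FK0.
pose I := [set U | [/\ B U, compact (closure U) & F `&` closure U = set0]].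
pose pE : ptopologicalType := HB.pack E (isPointed.Build E e).
have : @cover_compact pE K by rewrite -compact_cover.
move=> /(_ _ I id)[].
- by move=> U [BU _ _]; exact: bB.1.
- move=> x Kx; have Fx : ~ closed_set_val F x by move=> Fx; rewrite -[False]/(set0 x) -FK0.
  have [|U [BU Ux cU UF]] := @basis_nbhs _ x (~` F) bB.
    by apply: open_nbhs_nbhs; split => //; apply: closed_openC; exact: closed_setP.
  exists U => //; split => //; apply/seteqP; split => // y [Fy /UF].
  by move=> /(_ Fy).
move=> J sJ KJ.
apply: (@filterS _ _ _ (\bigcap_(U in [set` J]) miss (closure U))).
  move=> F' F'J; apply/seteqP; split => // x [F'x /KJ[U JU Ux]].
  by rewrite -(F'J _ JU); split => //; exact: subset_closure.
apply: filter_bigI => U /sJ; rewrite inE => -[BU cU FU].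
by apply: NW => //; left; exists U.
Qed.
End fell_borel.

Definition ray_line (R : realType) : Type := R.

Section ray_line.
Context (R : realType).

Definition ray_open : set_system (ray_line R) :=
  [set U | U = set0 \/ U = setT \/ exists a : R, U = [set x | a < x]].

Let ray_openT : ray_open setT. Proof. by right; left. Qed.

Let ray_openI (A B : set (ray_line R)) :
  ray_open A -> ray_open B -> ray_open (A `&` B).
Proof.
move=> [->|[->|[a ->]]]; rewrite ?set0I ?setTI; [by left|by []|].
move=> [->|[->|[b ->]]]; rewrite ?setI0 ?setIT; [by left|by right; right; exists a|].
right; right; exists (Num.max a b); apply/seteqP; split => x /=.
  by case=> ax bx; rewrite gt_max ax bx.
by rewrite gt_max => /andP[].
Qed.

Let ray_open_bigU (I : Type) (f : I -> set (ray_line R)) :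
  (forall i, ray_open (f i)) -> ray_open (\bigcup_i f i).
Proof.
move=> fo; have [[i fiT]|nT] := pselect (exists i, f i = setT).
  by right; left; apply/seteqP; split => // x _; exists i; rewrite ?fiT.
pose S : set R := [set a | exists i, f i = [set x | a < x]].
have fS i x : f i x -> exists2 a, S a & a < x.
  have [->//|[fiT|[a fia]]] := fo i; first by case: nT; exists i.
  by rewrite fia => ax; exists a => //; exists i.
have Sf a x : S a -> a < x -> (\bigcup_i f i) x.
  by move=> [i fi] ax; exists i => //; rewrite fi.
have [S0|/set0P S0] := eqVneq S set0.
  by left; apply/seteqP; split => // x [i _ /fS[a]]; rewrite S0.
have [lS|nlS] := pselect (has_lbound S); last first.
  right; left; apply/seteqP; split => // x _; apply: contrapT => nx.
  apply: nlS; exists x => a Sa; rewrite leNgt; apply/negP => ax.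
  by apply: nx; exact: Sf ax.
right; right; exists (inf S); apply/seteqP; split => x /=.
  by move=> [i _ /fS[a Sa ax]]; apply: le_lt_trans ax; exact: ge_inf.
move=> Sx; have [a Sa ax] := inf_lt S0 Sx.
exact: Sf ax.
Qed.

HB.instance Definition _ := Choice.on (ray_line R).
HB.instance Definition _ :=
  isOpenTopological.Build (ray_line R) ray_openT ray_openI ray_open_bigU.

End ray_line.

Definition eval_open (R : realType) (X : ptopologicalType)
    (O : {O : set X | open O}) (P : probability (borel X) R) : ray_line R :=
  fine (P (sval O)).

(* The initial topology with respect to the whole family [eval_open O], as the
   supremum of the initial topologies of its members. *)
Definition weak_probability (R : realType) (X : ptopologicalType) : Type :=
  sup_topology (fun O : {O : set X | open O} =>
    Topological.on (initial_topology (@eval_open R X O))).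

HB.instance Definition _ (R : realType) (X : ptopologicalType) :=
  Topological.copy (weak_probability R X)
    (sup_topology (fun O : {O : set X | open O} =>
      Topological.on (initial_topology (@eval_open R X O)))).

Definition directed_set (A : Type) (le : A -> A -> Prop) : Prop :=
  [/\ [set: A] !=set0,
      forall a, le a a,
      forall a b c, le a b -> le b c -> le a c &
      forall a b, exists c, le a c /\ le b c].

Definition tails (A : Type) (le : A -> A -> Prop) : set_system A :=
  filter_from [set: A] (fun a => [set b | le a b]).

Definition weakly_converges (R : realType) (X : ptopologicalType) (A : Type)
    (le : A -> A -> Prop) (P_ : A -> probability (borel X) R)
    (P : probability (borel X) R) : Prop :=
  P_ a @[a --> tails le] --> (P : weak_probability R X).

Definition dominates (R : realType) (E : topologicalType)
    (Q P : probability (borel (upper_fell E)) R) : Prop :=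
  forall (m : nat) (K : 'I_m -> set E), (0 < m)%N ->
    (forall i, compact (K i) /\ K i !=set0) ->
    (P (\bigcap_(i in [set: 'I_m]) hit (K i))
       <= Q (\bigcap_(i in [set: 'I_m]) hit (K i)))%E.

(* Main.v *)
Require Import Defs.
From HB Require Import structures.
From mathcomp Require Import all_boot all_order all_algebra finmap.
From mathcomp Require Import all_classical all_reals all_analysis.

(** Weak convergence of a net [P_ a] to [P] means that, for every open [O],
    the values [P_ a O] are eventually above any real number below [P O]
    ([weakly_convergesP]).  A limit can therefore be replaced by any
    probability that is smaller on all open sets ([weakly_converges_le]).

    In the upper Fell topology the sets [miss K], [K] compact, form a base,
    since [miss K `&` miss L = miss (K `|` L)].

    - If an open set [O] contains the point [E], it contains some [miss K]
      with [E] in [miss K]; then [K] is empty and [O] is the whole space.  So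
      the Dirac measure at [E] is 1 on the whole space and 0 on every other
      open set, and every net converges to it.

    - If [Q] dominates [P], then [Q O <= P O] for every open [O]
      ([dominates_le_open]).  Indeed, second countability makes [O] a countable
      union of sets [miss (K i)] ([upper_fell_countable_union]).  The union of
      the first [n] of them is the complement of the intersection of the
      [hit (K i)], on which domination compares [P] and [Q]; continuity from
      below then yields the inequality for [O]. *)

Set Implicit Arguments.
Unset Strict Implicit.
Unset Printing Implicit Defensive.
Import Order.TTheory GRing.Theory Num.Theory.

Local Open Scope classical_set_scope.
Local Open Scope ring_scope.

Section weak_convergence.
Context (R : realType) (X : ptopologicalType).
Implicit Types (P Q : probability (borel X) R) (O : set X).

Lemma open_borel_measurable O : open O -> measurable (O : set (borel X)).
Proof. exact: sub_sigma_algebra. Qed.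

(** Besides the whole line, the neighbourhoods of a point are the sets that
    contain an open upper ray around it. *)
Lemma ray_nbhsP (x : ray_line R) (U : set (ray_line R)) :
  nbhs x U <->
  U = setT \/ exists2 c : R, c < (x : R) & [set y : R | c < y] `<=` U.
Proof.
split.
  rewrite nbhsE => -[V [[->|[->|[c ->]]] Vx] VU] //.
  - by left; apply/seteqP; split => // y _; exact: VU.
  - by right; exists c.
move=> [->|[c cx cU]]; first exact: filterT.
apply: filterS cU _; apply: open_nbhs_nbhs; split => //.
by right; right; exists c.
Qed.

Context (A : Type) (le : A -> A -> Prop) (le_directed : directed_set le).

Lemma tails_filter : Filter (tails le).
Proof.
have [[a0 _] _ le_trans le_ub] := le_directed.
apply: filter_from_filter; first by exists a0.
move=> a b _ _; have [c [ac bc]] := le_ub a b; exists c => // d cd.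
by split; [exact: le_trans cd|exact: le_trans cd].
Qed.

(** The description of weak convergence by [liminf P_ a O >= P O] for all
    open [O]. *)
Lemma weakly_convergesP (P_ : A -> probability (borel X) R) P :
  weakly_converges le P_ P <->
  (forall O, open O -> forall c : R, c < fine (P O) ->
     tails le [set a | c < fine (P_ a O)]).
Proof.
have FF := tails_filter.
rewrite /weakly_converges; split.
  move=> cvgP O oO c cP.
  have cvgO := (@cvg_sup _ _ _ (P_ @ tails le) P _).1 cvgP (exist _ O oO).
  suff /cvgO : nbhs (P : initial_topology (@eval_open R X (exist _ O oO)))
    (@eval_open R X (exist _ O oO) @^-1` [set x : R | c < x]) by [].
  apply: (@initial_continuous _ _ (@eval_open R X (exist _ O oO)) P).
  by apply/ray_nbhsP; right; exists c.
move=> cvgP; apply/cvg_sup => -[G oG] U.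
have /= -> := @nbhsE (initial_topology (@eval_open R X (exist _ G oG))) P.
move=> -[V [[W oW <-] WP] VU].
apply: filterS VU _.
have /ray_nbhsP[->|[c cP cW]] : nbhs (@eval_open R X (exist _ G oG) P) W.
- exact: open_nbhs_nbhs.
- exact: filterT.
- by apply: filterS (cvgP G oG c cP) => a /cW.
Qed.

(** Weak convergence only bounds the limit from above on open sets, so a
    smaller probability on open sets is again a limit. *)
Lemma weakly_converges_le (P_ : A -> probability (borel X) R) P Q :
  (forall O, open O -> (Q O <= P O)%E) ->
  weakly_converges le P_ P -> weakly_converges le P_ Q.
Proof.
move=> QP /weakly_convergesP cvgP; apply/weakly_convergesP => O oO c cQ.
apply: cvgP => //; apply: lt_le_trans cQ _.
have mO := open_borel_measurable oO.
by apply: fine_le (QP _ oO); exact: fin_num_measure.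
Qed.

End weak_convergence.

Section upper_fell_base.
Context (E : topologicalType).
Implicit Types (O : set (upper_fell E)) (K : set E).

(** Sets [miss K] with [K] compact are stable under finite intersections,
    the empty one being [miss set0]. *)
Lemma finI_from_miss (I : choiceType) (W : set I) (f : I -> set (closed_set E))
    (C : set (closed_set E)) :
  (forall i, W i -> exists2 K, compact K & f i = miss K) -> finI_from W f C ->
  exists2 K, compact K & C = miss K.
Proof.
move=> Wmiss [D DW <-]; rewrite bigcap_fset big_seq.
apply: (big_ind (fun B => exists2 K, compact K & B = miss K)).
- exists set0; first exact: compact0.
  by apply/seteqP; split => // F _; rewrite /miss /= setI0.
- move=> _ _ [K cK ->] [L cL ->]; exists (K `|` L); first exact: compactU.
  apply/seteqP; split => F; rewrite /miss /= setIUr.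
    by move=> [-> ->]; rewrite setU0.
  by rewrite setU_eq0.
- by move=> i /DW; rewrite inE => /Wmiss.
Qed.

Lemma upper_fell_base O (F : closed_set E) : open O -> O F ->
  exists K, [/\ compact K, miss K F & miss K `<=` O].
Proof.
move=> [S sS <-] [C SC CF].
have [K cK CK] : exists2 K, compact K & C = miss K.
  by apply: finI_from_miss (sS _ SC) => _ [K cK <-]; exists K.
by exists K; split => //; rewrite -CK // => G CG; exists C.
Qed.

Context (lcE : locally_compact [set: E]) (hE : hausdorff_space E).

(** If the closed set [F] misses the compact set [K], then [K] is covered by
    finitely many basic open sets whose closures are compact and miss [F]. *)
Lemma compact_cover_closures (B : set (set E)) (F : closed_set E) K :
  basis B -> compact K -> miss K F ->
  exists2 J : {fset set E},
    {subset J <= [set U | B U /\ compact (closure U)]} &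
    (\bigcap_(U in [set` J]) miss (closure U)) F /\
    \bigcap_(U in [set` J]) miss (closure U) `<=` miss K.
Proof.
move=> bB cK FK0.
have [K0|/set0P[e _]] := eqVneq K set0.
  exists fset0%fset => //; rewrite set_fset0 bigcap_set0; split => // G _.
  by rewrite K0 /miss /= setI0.
pose I := [set U | [/\ B U, compact (closure U) & F `&` closure U = set0]].
(* [cover_compact] needs a pointed space; a point of [K] provides the base
   point. *)
pose pE : ptopologicalType := HB.pack E (isPointed.Build E e).
have /(_ _ I id)[] : @cover_compact pE K by rewrite -compact_cover.
- by move=> U [BU _ _]; exact: bB.1.
- move=> x Kx.
  have Fx : nbhs (x : E) (~` F).
    apply: open_nbhs_nbhs; split.
      by apply: closed_openC; exact: closed_setP.
    by move=> Fx; rewrite -[False]/(set0 x) -FK0.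
  have [U [BU Ux cU UF]] := basis_nbhs lcE hE bB Fx.
  exists U => //; split => //; apply/seteqP; split => // y [Fy /UF].
  by move=> /(_ Fy).
move=> J sJ KJ; exists J.
  by move=> U /sJ; rewrite !inE => -[].
split; first by move=> U /sJ; rewrite inE => -[].
move=> G GJ; apply/seteqP; split => // x [Gx /KJ[U JU Ux]].
by rewrite -(GJ _ JU); split => //; exact: subset_closure.
Qed.

(** This is the Lindelof property of open sets: the finite intersections of the sets [miss (closure U)], with [U] in a
    countable basis of [E] and [closure U] compact, form a countable base of
    the upper Fell topology. *)
Lemma upper_fell_countable_union O :
  @second_countable E -> open O -> O !=set0 ->
  exists2 K : nat -> set E,
    (forall i, compact (K i)) & O = \bigcup_i miss (K i).
Proof.
move=> [B cB bB] oO [F0 OF0].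
pose W := [set U | B U /\ compact (closure U)].
pose f U := miss (closure U : set E).
pose D := [set C | finI_from W f C /\ C `<=` O].
have missD C : D C -> exists2 K, compact K & C = miss K.
  by move=> [/finI_from_miss + _]; apply => U [_ cU]; exists (closure U).
have coverD F : O F -> exists2 C, D C & C F.
  move=> OF; have [K [cK KF KO]] := upper_fell_base oO OF.
  have [J JW [JF JK]] := compact_cover_closures bB cK KF.
  exists (\bigcap_(U in [set` J]) f U) => //; split; first by exists J.
  exact: subset_trans JK KO.
have /pfcard_geP[D0|/unsquash g] : countable D.
- have cW : countable W.
    by apply: sub_countable cB; apply: subset_card_le => U [].
  apply: sub_countable (finI_from_countable f cW).
  by apply: subset_card_le => C [].
- by have [C] := coverD _ OF0; rewrite D0.
have /choice[K gK] (i : nat) : exists K, compact K /\ g i = miss K.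
  by have [K cK gK] := missD _ (@funS _ _ _ _ g i I); exists K.
exists K => [i|]; first exact: (gK i).1.
apply/seteqP; split => F; first move=> /coverD[C DC CF].
  have [i _ giC] := @surj _ _ _ _ g _ DC; exists i => //.
  by rewrite -(gK i).2 giC.
move=> [i _]; have [_ gO] : D (g i) := @funS _ _ _ _ g i I.
by rewrite -(gK i).2 => /gO.
Qed.

End upper_fell_base.

Section domination.
Context (R : realType) (E : topologicalType).
Implicit Types P Q : probability (borel (upper_fell E)) R.

Lemma hit_compact_measurable (K : set E) :
  compact K -> measurable (hit K : set (borel (upper_fell E))).
Proof.
by move=> cK; rewrite hitE; apply: measurableC; exact: miss_measurable.
Qed.

(** In the definition of domination the restrictions to non-empty compact sets
    and to positive [m] are immaterial: an empty [K i] makes the intersection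
    empty, and the empty intersection is the whole space. *)
Lemma dominates_compact P Q (m : nat) (K : 'I_m -> set E) :
  dominates Q P -> (forall i, compact (K i)) ->
  (P (\bigcap_i hit (K i)) <= Q (\bigcap_i hit (K i)))%E.
Proof.
move=> QP cK; have [m0|m_gt0] := posnP m.
  suff -> : \bigcap_i hit (K i) = setT by rewrite !probability_setT.
  by apply/seteqP; split => // F _ i; have := ltn_ord i; rewrite {2}m0.
have [K0|/existsNP[i Ki0]] := pselect (forall i, K i !=set0).
  by apply: QP => // i; split.
suff -> : \bigcap_i hit (K i) = set0 by rewrite !measure0.
apply/seteqP; split => // F /(_ i I) [x [_ Kix]].
by case: Ki0; exists x.
Qed.

Lemma dominates_le_bigcup_miss P Q (n : nat) (K : nat -> set E) :
  dominates Q P -> (forall i, compact (K i)) ->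
  (Q (\bigcup_(i < n) miss (K i)) <= P (\bigcup_(i < n) miss (K i)))%E.
Proof.
move=> QP cK.
pose H := \bigcap_(i in [set: 'I_n]) hit (K i).
have -> : \bigcup_(i < n) miss (K i) = ~` H.
  rewrite /H setC_bigcap; apply/seteqP; split => F.
    by move=> [i ni Fi]; exists (Ordinal ni) => //; rewrite hitE setCK.
  by move=> [i _]; rewrite hitE setCK => Fi; exists i => /=.
have mH : measurable (H : set (borel (upper_fell E))).
  apply: fin_bigcap_measurable => // i _; exact: hit_compact_measurable.
rewrite !probability_setC//; apply: leeB => //.
exact: dominates_compact.
Qed.

Lemma dominates_le_open P Q (O : set (upper_fell E)) :
  locally_compact [set: E] -> @second_countable E -> hausdorff_space E ->
  dominates Q P -> open O -> (Q O <= P O)%E.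
Proof.
move=> lcE scE hE QP oO.
have [->|/set0P O0] := eqVneq O set0; first by rewrite !measure0.
have [K cK ->] := upper_fell_countable_union lcE hE scE oO O0.
pose G n : set (borel (upper_fell E)) := \bigcup_(i < n) miss (K i).
have GE : \bigcup_i miss (K i) = \bigcup_n G n.
  apply/seteqP; split => F.
    by move=> [i _ Fi]; exists i.+1 => //; exists i => /=.
  by move=> [n _ [i _ Fi]]; exists i.
have mG n : measurable (G n).
  by apply: bigcup_measurable => i _; exact: miss_measurable.
have homoG : {homo G : m n / (m <= n)%N >-> (m <= n)%O}.
  move=> m n mn; apply/subsetPset => F [i im Fi].
  by exists i => //; exact: leq_trans im mn.
rewrite GE; have mUG : measurable (\bigcup_n G n) by exact: bigcup_measurable.
apply: (lee_cvg_to (nondecreasing_cvg_mu mG mUG homoG)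
                   (nondecreasing_cvg_mu mG mUG homoG)).
by near=> n; exact: dominates_le_bigcup_miss.
Unshelve. all: by end_near.
Qed.

End domination.

Theorem lemma1 (R : realType) (E : topologicalType)
  (E_nonempty : ([set: E] !=set0)%classic)
  (E_locally_compact : locally_compact [set: E]%classic)
  (E_second_countable : @second_countable E)
  (E_hausdorff : hausdorff_space E)
  (A : Type) (le : A -> A -> Prop) (le_directed : directed_set le)
  (P_ : A -> probability (borel (upper_fell E)) R) :
  weakly_converges le P_ (@dirac _ (borel (upper_fell E)) (closed_setT E) R) /\
  (forall P : probability (borel (upper_fell E)) R,
     weakly_converges le P_ P ->
     forall Q : probability (borel (upper_fell E)) R,
       dominates Q P -> weakly_converges le P_ Q).
Proof.
split=> [|P cvgP Q QP]; last first.
  apply: (weakly_converges_le le_directed) cvgP => O.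
  exact: dominates_le_open.
apply/(weakly_convergesP le_directed) => O oO c.
have [[a0 _] _ _ _] := le_directed.
have [OT|nOT] := pselect (O (closed_setT E)).
  have [K [_ KT KO]] := upper_fell_base oO OT.
  have K0 : K = set0 by rewrite -(setTI K).
  have -> : O = setT.
    by apply/seteqP; split => // F _; apply: KO; rewrite /miss /= K0 setI0.
  rewrite probability_setT => c1; exists a0 => // a _ /=.
  by rewrite probability_setT.
rewrite /dirac /= indicE memNset// => c0; exists a0 => // a _ /=.
by apply: lt_le_trans c0 _; exact: fine_ge0.
Qed.
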